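(* Let $G=(V,E)$ be an oriented graph, $\omega=e^{2\pi i/5}$, and $V'\subseteq V$. Let $E'_1,E'_2,\dots$ be the edge sets $E'\subseteq E$ with $|E'|=|V'|$ such that $(V',E'_j)$ is all-regular, and for each $j$ let $n_\alpha^{(j)},n_\beta^{(j)},n_0^{(j)}$ be the numbers of alpha, beta and vanishing unicyclic components of $(V',E'_j)$ respectively. Then, with $\phi=(1+\sqrt5)/2$, $$\det L_\omega[V']=\sum_j \delta_0\big(n_0^{(j)}\big)\,(\sqrt5)^{\,n_\alpha^{(j)}+n_\beta^{(j)}}\,\phi^{\,n_\alpha^{(j)}-n_\beta^{(j)}},$$ where $\delta_0(x)=1$ if $x=0$ and $0$ otherwise.
   Context: An oriented graph is a finite directed graph with no loops, no multiple arcs, and no pair of opposite arcs. $L_\omega(G)$ is the $V\times V$ matrix with diagonal entry at $u$ the number of arcs incident with $u$ and $(u,v)$ entry ($u\ne v$) $-\omega$ if $u\to v$, $-\overline\omega$ if $v\to u$, $0$ otherwise; $L_\omega[V']$ is its principal submatrix on $V'$. A substructure is $(V',E')$ with $V'\subseteq V$, $E'\subseteq E$ (arcs may leave $V'$). Its connected components are the classes $V'_i$ of vertices of $V'$ joined by paths (ignoring directions) with vertices in $V'$ and arcs in $E'$, together with the sets $E'_i$ of arcs of $E'$ having an endpoint in $V'_i$; it is all-regular if $|V'_i|=|E'_i|$ for all $i$. A unicyclic component is a component whose arcs all have both ends in $V'_i$ and whose underlying graph is connected with exactly one cycle. For a cycle of length $k$, traverse it in the direction for which the number $g$ of arcs against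 the traversal satisfies $0\le g\le\lfloor k/2\rfloor$ ($g$ = number of negative arcs). A unicyclic component whose cycle has length $k$ and $g$ negative arcs is called alpha if $k-2g\equiv 2,3\pmod 5$, beta if $k-2g\equiv1,4\pmod5$, and vanishing if $k-2g\equiv0\pmod5$. *)

(* Defs.v *)
From HB Require Import structures.
From mathcomp Require Import all_boot all_order all_algebra.
From mathcomp Require Import reals trigo.
From mathcomp Require Import complex.
Set Implicit Arguments. Unset Strict Implicit. Unset Printing Implicit Defensive.
Import Order.TTheory GRing.Theory Num.Theory.
Local Open Scope ring_scope.

Section OrientedGraphs.
Variable V : finType.

(* An oriented graph on the vertex set V is given by its arc set E : {set V * V},
   where (u, v) \in E means u -> v. *)
Definition oriented (E : {set V * V}) : Prop :=
  (forall u, (u, u) \notin E) /\ (forall u v, (u, v) \in E -> (v, u) \notin E).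

Definition sadj (V' : {set V}) (E' : {set V * V}) : rel V :=
  fun u v => [&& u \in V', v \in V' & ((u, v) \in E') || ((v, u) \in E')].

Definition comps (V' : {set V}) (E' : {set V * V}) : {set {set V}} :=
  [set [set y | connect (sadj V' E') x y] | x in V'].

Definition comp_arcs (E' : {set V * V}) (C : {set V}) : {set V * V} :=
  [set e in E' | (e.1 \in C) || (e.2 \in C)].

Definition all_regular (V' : {set V}) (E' : {set V * V}) : bool :=
  [forall C in comps V' E', #|C| == #|comp_arcs E' C|].

(* Cycles.  A cycle is given by a sequence c = [:: v_0; ...; v_{k-1}] of distinct
   vertices, k >= 3, consecutive (cyclically) vertices being joined by an arc of F. *)
Definition cyc_pairs (c : seq V) : seq (V * V) := zip c (rot 1 c).
Definition joined (F : {set V * V}) (p : V * V) : bool :=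
  (p \in F) || ((p.2, p.1) \in F).
Definition is_cyc (F : {set V * V}) (c : seq V) : bool :=
  [&& uniq c, (2 < size c)%N & all (joined F) (cyc_pairs c)].
Definition cyc_set (F : {set V * V}) (c : seq V) : {set V * V} :=
  [set e in F | (e \in cyc_pairs c) || ((e.2, e.1) \in cyc_pairs c)].
(* The set of (arc sets of) cycles of F; a cycle has at most #|V| vertices. *)
Definition cycle_sets (F : {set V * V}) : {set {set V * V}} :=
  [set S | [exists k : 'I_#|V|.+1, exists t : k.-tuple V,
             is_cyc F t && (S == cyc_set F t)]].

Definition unicyclic (E' : {set V * V}) (C : {set V}) : bool :=
  [forall e in comp_arcs E' C, (e.1 \in C) && (e.2 \in C)] &&
  (#|cycle_sets (comp_arcs E' C)| == 1).

(* For a cycle traversed along c (in F): k = size c, the number of arcs along the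
   traversal and against it; g = number of negative arcs for the traversal direction
   with g <= k/2, i.e. g = min(forward, backward).  cyc_val = k - 2g. *)
Definition n_fwd (F : {set V * V}) (c : seq V) : nat := count (mem F) (cyc_pairs c).
Definition cyc_val (F : {set V * V}) (c : seq V) : nat :=
  (size c - 2 * minn (n_fwd F c) (size c - n_fwd F c))%N.

Definition cyc_class (E' : {set V * V}) (C : {set V}) (r : seq nat) : bool :=
  unicyclic E' C &&
  [exists k : 'I_#|V|.+1, exists t : k.-tuple V,
     is_cyc (comp_arcs E' C) t && ((cyc_val (comp_arcs E' C) t %% 5)%N \in r)].

Definition alpha_comp E' C := cyc_class E' C [:: 2; 3]%N.
Definition beta_comp E' C := cyc_class E' C [:: 1; 4]%N.
Definition vanishing_comp E' C := cyc_class E' C [:: 0]%N.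

Definition n_alpha V' E' : nat := #|[set C in comps V' E' | alpha_comp E' C]|.
Definition n_beta V' E' : nat := #|[set C in comps V' E' | beta_comp E' C]|.
Definition n_zero V' E' : nat := #|[set C in comps V' E' | vanishing_comp E' C]|.

Variable R : realType.
Local Open Scope complex_scope.

Definition omega5 : R[i] := cos (2 * pi / 5) +i* sin (2 * pi / 5).

Definition Lw (E : {set V * V}) (w : R[i]) (u v : V) : R[i] :=
  if u == v then (#|[set e in E | (e.1 == u) || (e.2 == u)]|)%:R
  else if (u, v) \in E then - w
  else if (v, u) \in E then - w^*
  else 0.

Definition Lsub (E : {set V * V}) (w : R[i]) (V' : {set V}) : 'M[R[i]]_#|V'| :=
  \matrix_(i, j) Lw E w (enum_val i) (enum_val j).

Definition sqrt5 : R[i] := (Num.sqrt (5 : R))%:C.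
Definition phi_gold : R[i] := (1 + sqrt5) / 2.

End OrientedGraphs.

(* Main.v *)
Require Import Defs.
From HB Require Import structures.
From mathcomp Require Import all_boot all_order all_algebra.
From mathcomp Require Import perm.
From mathcomp Require Import reals trigo.
From mathcomp Require Import complex.
From mathcomp Require Import ring lra zify.
Import Order.TTheory GRing.Theory Num.Theory.
Local Open Scope ring_scope.
Set Implicit Arguments. Unset Strict Implicit. Unset Printing Implicit Defensive.

(** The matrix [Lw E w] is [N N^*] for a weighted incidence matrix [N], so by
    Cauchy-Binet its principal minor on [V'] is the sum, over the arc sets [F]
    with [#|F| = #|V'|], of the same minor for [F] alone. The latter is block
    diagonal along the components of [(V', F)], and a block with fewer arcs than
    vertices vanishes. For a regular component, a spanning tree rooted at [r]
    makes the incidence matrix triangular with unit entries, up to the column of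
    the one remaining arc. If that arc is dangling at [r] the block is 1. If it
    closes a cycle through [r], telescoping around the cycle turns this column
    into [1 - P] times the indicator of [r], where [P] is the product of the arc
    weights around the cycle, so the block is [|1 - P|^2 = 2 - w^n - w^-n] with
    [n = k - 2g]. At a primitive fifth root of unity this is [sqrt 5 * phi],
    [sqrt 5 / phi] or [0]. Finally, a connected graph with as many arcs as
    vertices has exactly one cycle: otherwise an arc could be deleted from each
    of two cycles without disconnecting it, leaving too few arcs. *)

Local Arguments conjc : simpl never.

(** * Minors indexed by finite sets *)

Definition minor_det (K : comNzRingType) (T : finType) (A : {set T})
    (M : T -> T -> K) : K :=
  \det (\matrix_(i < #|A|, j < #|A|) M (enum_val i) (enum_val j)).

(** Two enumerations of the same set differ by a permutation acting on rows and columns at once, so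
    its sign occurs squared. *)
Lemma det_reindex (K : comNzRingType) (T : finType) (M : T -> T -> K) (m n : nat)
    (f : 'I_m -> T) (g : 'I_n -> T) :
    injective f -> injective g -> codom f =i codom g ->
  \det (\matrix_(i, j) M (f i) (f j)) = \det (\matrix_(i, j) M (g i) (g j)).
Proof.
move=> f_inj g_inj fg.
have mn : m = n.
  by rewrite -(card_ord m) -(card_codom f_inj) (eq_card fg) card_codom // card_ord.
subst n; have fP i : f i \in codom g by rewrite -fg codom_f.
pose s i := iinv (fP i); have gs i : g (s i) = f i by rewrite /s f_iinv.
have s_inj : injective s by move=> i j eq_s; apply: f_inj; rewrite -!gs eq_s.
pose p := perm s_inj; set B := (X in _ = \det X).
have -> : \matrix_(i, j) M (f i) (f j) = row_perm p (col_perm p B).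
  by apply/matrixP=> i j; rewrite !mxE !permE !gs.
rewrite row_permE col_permE !det_mulmx !det_perm odd_permV mulrCA.
by rewrite -expr2 sqrr_sign mulr1.
Qed.

Lemma minor_det_reindex (K : comNzRingType) (T : finType) (M : T -> T -> K)
    (A : {set T}) (n : nat) (f : 'I_n -> T) :
    injective f -> codom f =i A ->
  minor_det A M = \det (\matrix_(i, j) M (f i) (f j)).
Proof.
move=> f_inj fA; apply: det_reindex => //; first exact: enum_val_inj.
move=> x; rewrite fA; apply/codomP/idP => [[i ->]|xA]; first exact: enum_valP.
by exists (enum_rank_in xA x); rewrite enum_rankK_in.
Qed.

Lemma eq_minor_det (K : comNzRingType) (T : finType) (A : {set T})
    (M M' : T -> T -> K) :
  {in A &, forall x y, M x y = M' x y} -> minor_det A M = minor_det A M'.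
Proof.
move=> eqM; congr (\det _); apply/matrixP=> i j.
by rewrite !mxE eqM ?enum_valP.
Qed.

Lemma minor_det_set0 (K : comNzRingType) (T : finType) (M : T -> T -> K) :
  minor_det set0 M = 1.
Proof.
have f (i : 'I_0) : T by case: i.
rewrite (@minor_det_reindex _ _ _ _ 0 f); first exact: det_mx00.
- by case.
- by move=> x; rewrite inE; apply/codomP=> [[[]]].
Qed.

Lemma minor_det_set1 (K : comNzRingType) (T : finType) (M : T -> T -> K) (x : T) :
  minor_det [set x] M = M x x.
Proof.
rewrite (@minor_det_reindex _ _ _ _ 1 (fun=> x)).
- by rewrite det_mx11 mxE.
- by move=> i j _; rewrite !ord1.
- move=> y; rewrite inE; apply/codomP/eqP => [[i ->]|->] //.
  by exists ord0.
Qed.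

(** Listing [A] before [B] makes the matrix block lower triangular: the zero entries from [A] to [B]
    form the upper right block. *)
Lemma minor_detU (K : comNzRingType) (T : finType) (A B : {set T})
    (M : T -> T -> K) :
    [disjoint A & B] -> {in A & B, forall x y, M x y = 0} ->
  minor_det (A :|: B) M = minor_det A M * minor_det B M.
Proof.
move=> disAB M0.
pose f (i : 'I_(#|A| + #|B|)) : T :=
  match split i with inl a => enum_val a | inr b => enum_val b end.
have fl a : f (lshift _ a) = enum_val a by rewrite /f (unsplitK (inl a)).
have fr b : f (rshift _ b) = enum_val b by rewrite /f (unsplitK (inr b)).
rewrite (@minor_det_reindex _ _ _ _ _ f).
- rewrite -(@det_lblock _ _ _ _ (\matrix_(i, j) M (enum_val i) (enum_val j))).
  congr (\det _); apply/matrixP=> i j.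
  rewrite -(splitK i) -(splitK j).
  case: (split i) => a; case: (split j) => b /=;
    rewrite ?block_mxEul ?block_mxEur ?block_mxEdl ?block_mxEdr !mxE ?fl ?fr //.
  by rewrite M0 ?enum_valP.
- move=> i j; rewrite -(splitK i) -(splitK j).
  case: (split i) => a; case: (split j) => b /=; rewrite ?fl ?fr.
  + by move/enum_val_inj->.
  + by move=> eqab; have := disjointFr disAB (enum_valP a); rewrite eqab enum_valP.
  + by move=> eqab; have := disjointFr disAB (enum_valP b); rewrite -eqab enum_valP.
  + by move/enum_val_inj->.
- move=> x; rewrite inE; apply/codomP/orP => [[i ->]|[xA|xB]].
  + rewrite -(splitK i); case: (split i) => a /=; rewrite ?fl ?fr enum_valP;
    by [left|right].
  + by exists (lshift _ (enum_rank_in xA x)); rewrite fl enum_rankK_in.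
  + by exists (rshift _ (enum_rank_in xB x)); rewrite fr enum_rankK_in.
Qed.

(** Induction splitting off an index [x] with [d x] maximal, whose row is zero off the diagonal.
    Ties in [d] do no harm, since entries between distinct indices of equal [d] vanish too. *)
Lemma minor_det_trig (K : comNzRingType) (T : finType) (d : T -> nat) (A : {set T})
    (M : T -> T -> K) :
    {in A &, forall x y, x != y -> (d y <= d x)%N -> M x y = 0} ->
  minor_det A M = \prod_(x in A) M x x.
Proof.
have [n] := ubnP #|A|; elim: n A => // n IH A; rewrite ltnS => leAn M0.
have [->|[x0 x0A]] := set_0Vmem A; first by rewrite minor_det_set0 big_set0.
case: (@arg_maxnP _ x0 (mem A) d x0A) => x /= xA xmax.
rewrite (big_setD1 x) //= -(setD1K xA) minor_detU.
- rewrite minor_det_set1 setU1K ?setD11 // IH //.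
  + by apply: leq_trans leAn; rewrite (cardsD1 x A) xA.
  + by move=> y z; rewrite !inE => /andP[_ yA] /andP[_ zA]; apply: M0.
- by rewrite disjoints1 setD11.
- move=> y z; rewrite !inE => /eqP-> /andP[zx zA].
  by apply: M0; rewrite // 1?eq_sym //; apply: xmax.
Qed.

Lemma minor_det_mul (K : comNzRingType) (T : finType) (A : {set T})
    (M N : T -> T -> K) :
  minor_det A (fun x y => \sum_(z in A) M x z * N z y) = minor_det A M * minor_det A N.
Proof.
rewrite -det_mulmx; congr (\det _); apply/matrixP=> i j; rewrite !mxE.
rewrite (big_enum_val (fun z => M (enum_val i) z * N z (enum_val j))).
by apply: eq_bigr => k _; rewrite !mxE.
Qed.

Lemma minor_det_partition (K : comNzRingType) (T : finType) (P : {set {set T}})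
    (M : T -> T -> K) :
    trivIset P ->
    {in P &, forall A B : {set T}, A != B -> {in A & B, forall x y, M x y = 0}} ->
  minor_det (cover P) M = \prod_(A in P) minor_det A M.
Proof.
have [n] := ubnP #|P|; elim: n P => // n IH P; rewrite ltnS => lePn tP M0.
have [->|[A AP]] := set_0Vmem P.
  by rewrite /cover !big_set0 minor_det_set0.
rewrite (big_setD1 A) //= -IH; first last.
- by move=> B C; rewrite !inE => /andP[_ BP] /andP[_ CP]; apply: M0.
- by apply: trivIsetS tP; apply: subD1set.
- by apply: leq_trans lePn; rewrite (cardsD1 A P) AP.
rewrite -minor_detU.
- by congr (minor_det _ _); rewrite {1}/cover (big_setD1 A).
- apply: bigcup_disjoint => B; rewrite !inE => /andP[BA BP].
  by move/trivIsetP: tP; apply; rewrite // eq_sym.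
- move=> x y xA /bigcupP[B]; rewrite !inE => /andP[BA BP] yB.
  by apply: (M0 A B) => //; rewrite eq_sym.
Qed.

(** Multilinearity in the rows: expanding all the sums amounts to choosing one index [g i] in [Q]
    for each row [i]. *)
Lemma det_sum_expand (K : comNzRingType) (n : nat) (I : finType) (Q : {set I})
    (a : 'I_n -> I -> K) (b : I -> 'I_n -> K) :
  \det (\matrix_(i, j) \sum_(e in Q) a i e * b e j) =
  \sum_(g : {ffun 'I_n -> I} | g \in ffun_on (mem Q))
     (\prod_i a i (g i)) * \det (\matrix_(i, j) b (g i) j).
Proof.
rewrite /determinant; under [RHS]eq_bigr => g _ do rewrite mulr_sumr.
rewrite exchange_big /=; apply: eq_bigr => s _.
under eq_bigr => i _ do rewrite mxE.
rewrite (bigA_distr_big (mem Q) (fun i e => a i e * b e (s i))) mulr_sumr.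
apply: eq_bigr => g _; rewrite big_split /= mulrCA; congr (_ * (_ * _)).
by apply: eq_bigr => i _; rewrite mxE.
Qed.

(* Cauchy-Binet, grouped by the image of the index function: choice functions
   that are not injective contribute a determinant with two equal rows. *)
Lemma minor_det_sum_subsets (K : comNzRingType) (T I : finType) (A : {set T})
    (Q : {set I}) (a : T -> I -> K) (b : I -> T -> K) :
  minor_det A (fun x y => \sum_(e in Q) a x e * b e y) =
  \sum_(F : {set I} | (F \subset Q) && (#|F| == #|A|))
     minor_det A (fun x y => \sum_(e in F) a x e * b e y).
Proof.
pose t (g : {ffun 'I_#|A| -> I}) : K :=
  (\prod_i a (enum_val i) (g i)) * \det (\matrix_(i, j) b (g i) (enum_val j)).
have expd (F : {set I}) :
    minor_det A (fun x y => \sum_(e in F) a x e * b e y) =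
    \sum_(g : {ffun 'I_#|A| -> I} | injectiveb g && ([set g i | i in 'I_#|A|] \subset F)) t g.
  rewrite /minor_det (det_sum_expand F (fun i e => a (enum_val i) e)
             (fun e j => b e (enum_val j))) -/t.
  rewrite (bigID (fun g : {ffun 'I_#|A| -> I} => injectiveb g)) /= [X in _ + X]big1 ?addr0.
    apply: eq_bigl => g; rewrite andbC; congr (_ && _).
    apply/ffun_onP/subsetP => [gF e /imsetP[i _ ->]|gF i]; first exact: gF.
    by apply: gF; apply: imset_f.
  move=> g /andP[_ /injectivePn[i [j ij gij]]].
  rewrite (determinant_alternate ij) ?mulr0 // => k.
  by rewrite !mxE gij.
rewrite expd (partition_big (fun g : {ffun 'I_#|A| -> I} => [set g i | i in 'I_#|A|])
  (fun F => (F \subset Q) && (#|F| == #|A|))) /=; last first.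
  by move=> g /andP[/injectiveP g_inj ->]; rewrite card_imset // card_ord eqxx.
apply: eq_bigr => F /andP[FQ /eqP cF]; rewrite expd; apply: eq_bigl => g.
(* By cardinality, an injective choice with image inside [F] has image exactly [F]. *)
case: (injectiveP g) => //= g_inj; apply/andP/idP => [[_ /eqP->] //|gF].
suff -> : [set g i | i in 'I_#|A|] = F by [].
by apply/eqP; rewrite eqEcard gF cF card_imset // card_ord leqnn.
Qed.

(** * Connected components and cycles *)

Definition conn (V : finType) (C : {set V}) (G : {set V * V}) : Prop :=
  {in C &, forall x y, connect (sadj C G) x y}.

Definition inner (V : finType) (C : {set V}) (G : {set V * V}) : Prop :=
  {in G, forall e, (e.1 \in C) && (e.2 \in C)}.

Lemma sadj_sym (V : finType) (C : {set V}) (G : {set V * V}) : symmetric (sadj C G).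
Proof. by move=> u v; rewrite /sadj andbCA orbC. Qed.

(** The classes in [comps] are not cut down to [C], but [sadj] only relates vertices of [C], so a
    class that starts in [C] stays there. *)
Lemma comps_equivalence_partition (V : finType) (C : {set V}) (F : {set V * V}) :
  comps C F = equivalence_partition (connect (sadj C F)) C.
Proof.
apply: eq_in_imset => x xC; apply/setP=> y; rewrite !inE.
apply/idP/andP => [xy|[]//]; split=> //.
case/connectP: xy => s; elim: s x xC => [|z s IH] x xC /=; first by move=> _ ->.
by case/andP=> /and3P[_ zC _]; apply: IH.
Qed.

Lemma comps_partition (V : finType) (C : {set V}) (F : {set V * V}) :
  partition (comps C F) C.
Proof.
rewrite comps_equivalence_partition; apply: equivalence_partitionP => x y z _ _ _.
by split=> // xy; rewrite (same_connect (sym_connect_sym (@sadj_sym _ _ _)) xy).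
Qed.

Lemma comps_closed (V : finType) (V' C : {set V}) (F : {set V * V}) (u v : V) :
  C \in comps V' F -> u \in C -> sadj V' F u v -> v \in C.
Proof.
case/imsetP=> x _ ->; rewrite !inE => xu uv.
exact: connect_trans xu (connect1 uv).
Qed.

(** A path that starts in [C] never leaves it, and each of its arcs touches [C], so it survives the
    restriction to [comp_arcs F C]. *)
Lemma comps_conn (V : finType) (V' C : {set V}) (F : {set V * V}) :
  C \in comps V' F -> conn C (comp_arcs F C).
Proof.
move=> CP; have stepC := comps_closed CP.
have key x y : x \in C -> connect (sadj V' F) x y -> connect (sadj C (comp_arcs F C)) x y.
  move=> xC /connectP[s]; elim: s x xC => [|z s IH] x xC /=; first by move=> _ ->.
  case/andP=> xz zs eqy; have zC := stepC _ _ xC xz.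
  apply: connect_trans (IH z zC zs eqy); apply: connect1.
  by case/and3P: xz => _ _ xz; rewrite /sadj xC zC !inE /= xC zC orbT !andbT.
move=> x y xC yC; apply: key => //.
case/imsetP: CP xC yC => z _ ->; rewrite !inE => zx zy.
by apply: connect_trans zy; rewrite (sym_connect_sym (@sadj_sym _ _ _)).
Qed.

Lemma joined_setD1 (V : finType) (G : {set V * V}) (e : V * V) (a b : V) :
  joined G (a, b) -> e != (a, b) -> e != (b, a) -> joined (G :\ e) (a, b).
Proof. by rewrite /joined !inE ![_ == e]eq_sym => ? -> ->. Qed.

(* The arcs [q u] form a spanning tree of [C] rooted at [r]: [q u] joins [u] to
   its parent [p u], and [d] decreases towards the root. *)
Definition spanning (V : finType) (C : {set V}) (G : {set V * V}) (r : V)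
    (d : V -> nat) (p : V -> V) (q : V -> V * V) : Prop :=
  {in C :\ r, forall u, [/\ p u \in C, (d (p u) < d u)%N, q u \in G &
     q u = (u, p u) \/ q u = (p u, u)]}.

(** Breadth-first tree: [d u] is the length of a shortest path from [r] to [u], and [p u] is the
    vertex before [u] on such a path. *)
Lemma conn_spanning (V : finType) (C : {set V}) (G : {set V * V}) (r : V) :
  conn C G -> r \in C -> exists d p q, spanning C G r d p q.
Proof.
move=> cC rC; pose P u n := [exists t : n.-tuple V, path (sadj C G) r t && (last r t == u)].
have [d dP] : exists d : V -> nat, forall u, u \in C ->
    P u (d u) /\ forall m, P u m -> (d u <= m)%N.
  apply: (@fin_all_exists V (fun=> nat)
    (fun u n => u \in C -> P u n /\ forall m, P u m -> (n <= m)%N)) => u.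
  have [uC|_] := boolP (u \in C); last by exists 0%N.
  have exP : exists n, P u n.
    have /connectP[s rs ->] := cC _ _ rC uC.
    by exists (size s); apply/existsP; exists (in_tuple s); rewrite rs /=.
  by exists (ex_minn exP) => _; case: ex_minnP.
have [p pP] : exists p : V -> V, forall u, u \in C :\ r ->
    [&& p u \in C, (d (p u) < d u)%N & joined G (u, p u)].
  apply: (@fin_all_exists V (fun=> V) (fun u v => u \in C :\ r ->
    [&& v \in C, (d v < d u)%N & joined G (u, v)])) => u.
  have [|_] := boolP (u \in C :\ r); last by exists u.
  rewrite !inE => /andP[ur uC]; have [/existsP[t /andP[rt /eqP lt]] _] := dP u uC.
  case: t rt lt => /= t; case/lastP: t => [|t w] tn.
    by move=> _ /= ru; rewrite ru eqxx in ur.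
  rewrite rcons_path last_rcons => /andP[rt vw] eqw; exists (last r t) => _.
  subst w; case/and3P: (vw) => vC _ vu; rewrite vC /joined /= orbC vu andbT /=.
  rewrite -(eqP tn) size_rcons ltnS; apply: (dP _ vC).2.
  by apply/existsP; exists (in_tuple t); rewrite rt /=.
exists d, p, (fun u => if (u, p u) \in G then (u, p u) else (p u, u)) => u.
move=> /pP /and3P[pC dlt]; rewrite /joined /=; case: ifP => [uG _|_ /= puG]; split=> //.
  by left.
by right.
Qed.

Section Spanning.
Variables (V : finType) (C : {set V}) (G : {set V * V}) (r : V).
Variables (d : V -> nat) (p : V -> V) (q : V -> V * V).
Hypothesis sp : spanning C G r d p q.

(** Two distinct vertices sharing a tree arc would be parents of each other, and [d] would decrease
    both ways. *)
Lemma spanning_inj : {in C :\ r &, injective q}.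
Proof.
move=> u v uC vC eqq; have [_ du _ qu] := sp uC; have [_ dv _ qv] := sp vC.
case: qu => equ; case: qv => eqv; move: eqq; rewrite equ eqv => -[uv vu] //.
  by move: du dv; rewrite vu -uv => du dv; have := ltn_trans du dv; rewrite ltnn.
by move: du dv; rewrite uv -vu => du dv; have := ltn_trans du dv; rewrite ltnn.
Qed.

Lemma spanning_conn (G1 : {set V * V}) :
  {in C :\ r, forall u, q u \in G1} -> r \in C -> conn C G1.
Proof.
move=> qG1 rC; have csym := sym_connect_sym (@sadj_sym V C G1).
have ur u : u \in C -> connect (sadj C G1) u r.
  have [n] := ubnP (d u); elim: n u => // n IH u; rewrite ltnS => dn uC.
  have [->//|ur] := eqVneq u r.
  have uCr : u \in C :\ r by rewrite !inE ur.
  have [pC dlt _ qu] := sp uCr; apply: connect_trans (IH _ (leq_trans dlt dn) pC).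
  apply: connect1; rewrite /sadj uC pC /=; have := qG1 u uCr.
  by case: qu => -> ->; rewrite ?orbT.
by move=> x y xC yC; apply: connect_trans (ur x xC) _; rewrite csym ur.
Qed.

(** Giving the root the extra arc [e] makes the arc assignment injective on all of [C]; when the
    cardinals agree it is a bijection, which lets vertices index the columns of the incidence
    matrix. *)
Lemma spanning_extend (G' : {set V * V}) (e : V * V)
    (q' := fun u => if u == r then e else q u) :
    G \subset G' -> e \in G' -> {in C :\ r, forall u, q u != e} ->
  {in C &, injective q'} /\ {in C, forall u, q' u \in G'}.
Proof.
move=> GG' eG' qe; have q'r : q' r = e by rewrite /q' eqxx.
have q'q u : u != r -> q' u = q u by rewrite /q' => /negPf->.
have inCr u : u \in C -> u != r -> u \in C :\ r by rewrite !inE => -> ->.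
split=> [u v uC vC|u uC]; last first.
  have [->|ur] := eqVneq u r; rewrite ?q'r ?q'q //; apply: (subsetP GG').
  by have [] := sp (inCr u uC ur).
have [->|ur] := eqVneq u r; have [->|vr] := eqVneq v r => //.
- by rewrite q'r q'q // => eqe; have := qe v (inCr v vC vr); rewrite -eqe eqxx.
- by rewrite q'r q'q // => eqe; have := qe u (inCr u uC ur); rewrite eqe eqxx.
- by rewrite !q'q // => /(spanning_inj (inCr u uC ur) (inCr v vC vr)).
Qed.

End Spanning.

Lemma conn_card (V : finType) (C : {set V}) (G : {set V * V}) :
  conn C G -> (#|C| <= #|G|.+1)%N.
Proof.
move=> cC; have [->|[r rC]] := set_0Vmem C; first by rewrite cards0.
have [d [p [q sp]]] := conn_spanning cC rC.
rewrite (cardsD1 r) rC add1n ltnS -(card_in_imset (spanning_inj sp)).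
by apply/subset_leq_card/subsetP => _ /imsetP[u /sp[_ _ qG _] ->].
Qed.

(** Each use of [e] in a path is replaced by the detour between its ends. *)
Lemma conn_setD1 (V : finType) (C : {set V}) (G : {set V * V}) (e : V * V) :
  conn C G -> connect (sadj C (G :\ e)) e.1 e.2 -> conn C (G :\ e).
Proof.
move=> cC ce x y xC yC; have csym := sym_connect_sym (@sadj_sym V C (G :\ e)).
suff sub : subrel (sadj C G) (connect (sadj C (G :\ e))).
  exact: (connect_sub sub (cC x y xC yC)).
move=> u v /and3P[uC vC uv].
have [eqe|neqe] := eqVneq e (u, v); first by rewrite eqe in ce *.
have [eqe|neqe'] := eqVneq e (v, u); first by rewrite csym eqe in ce *.
by apply: connect1; rewrite /sadj uC vC; apply: joined_setD1.
Qed.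

(** * Cycles in connected arc sets *)

Lemma cyc_pairs_cons (V : finType) (x : V) (s : seq V) :
  cyc_pairs (x :: s) = pairmap pair x (rcons s x).
Proof.
(* The closing vertex is generalised apart from the starting one, because only the latter changes in
   the induction. *)
rewrite /cyc_pairs rot1_cons; move: {2 4}x => y.
by elim: s x => [|z s IH] x //=; rewrite IH.
Qed.

Lemma is_cycE (V : finType) (F : {set V * V}) (c : seq V) :
  is_cyc F c = [&& uniq c, (2 < size c)%N & cycle (fun u v => joined F (u, v)) c].
Proof.
congr [&& _, _ & _]; case: c => // x s; rewrite cyc_pairs_cons /=.
by move: (rcons s x) => s'; elim: s' x => //= z s' IH x; rewrite IH.
Qed.

Lemma is_cyc_rot (V : finType) (F : {set V * V}) (n : nat) (c : seq V) :
  is_cyc F (rot n c) = is_cyc F c.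
Proof. by rewrite !is_cycE rot_uniq size_rot rot_cycle. Qed.

Lemma mem_pairmap_pair (T : eqType) (x a b : T) (s : seq T) :
  (a, b) \in pairmap pair x s -> exists s1 s2, x :: s = s1 ++ [:: a, b & s2].
Proof.
elim: s x => [|z s IH] x //=; rewrite inE => /orP[/eqP[-> ->]|/IH[s1 [s2 ->]]].
  by exists [::], s.
by exists (x :: s1), s2.
Qed.

(** Allows any arc of a cycle to be treated as its first one. *)
Lemma cyc_pairs_rot (V : finType) (c : seq V) (a b : V) :
    (1 < size c)%N -> (a, b) \in cyc_pairs c ->
  exists n s, rot n c = [:: a, b & s].
Proof.
case: c => // x s sz; rewrite cyc_pairs_cons => /mem_pairmap_pair[s1 [s2]].
case: s1 => [[]|y s1 [_]].
  by move=> <-; case: s sz => //= z s _ [-> _]; exists 0%N, s; rewrite rot0.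
(* With [s2] empty, the pair is the one closing the cycle, and the rotation starts at the last
   vertex. *)
case/lastP: s2 => [|s2 z].
  rewrite -(cat_rcons a) cats1 => /rcons_inj[-> <-].
  exists (size (x :: s1)), s1.
  by rewrite -cats1 -cat_cons rot_size_cat.
rewrite -2!rcons_cons -rcons_cat => /rcons_inj[-> _].
by exists (size (x :: s1)), (s2 ++ x :: s1); rewrite -cat_cons rot_size_cat.
Qed.

(** The rest of the cycle leads from [y] back to [x] without [e], because the vertices are distinct
    and there are at least three. *)
Lemma cyc_tail (V : finType) (G : {set V * V}) (e : V * V) (x y : V) (s : seq V) :
    is_cyc G [:: x, y & s] -> e = (x, y) \/ e = (y, x) ->
  path (fun u v => joined (G :\ e) (u, v)) y (rcons s x).
Proof.
rewrite is_cycE => /and3P[us]; case/lastP: s us => // s z us _ /= /andP[_].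
rewrite ![path _ y (rcons (rcons s z) x)]rcons_path last_rcons => /andP[ps zx] exy.
move: us; rewrite /= rcons_uniq !(inE, mem_rcons) !negb_or -!andbA.
case/and5P=> xy xz xs yz _.
apply/andP; split.
  (* All pairs but the last avoid [x]; the last one, from [z] to [x], avoids [y]. *)
  apply: (@sub_in_path _ (predC1 x) _ _ _ y (rcons s z) _ ps).
    move=> u v; rewrite !inE => ux vx uv; apply: joined_setD1 uv _ _;
    by case: exy => ->; rewrite eq_sym xpair_eqE ?(negPf ux) ?(negPf vx) ?andbF.
  rewrite /= all_rcons /= [y == x]eq_sym xy [z == x]eq_sym xz /=.
  by apply/allP=> u us; apply: contraNneq xs => <-.
apply: joined_setD1 zx _ _;
  by case: exy => ->; rewrite xpair_eqE ?(negPf xz) ?(negPf yz) ?andbF.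
Qed.

Lemma innerD1 (V : finType) (C : {set V}) (G : {set V * V}) (e : V * V) :
  inner C G -> inner C (G :\ e).
Proof. by move=> iG a /setD1P[_ /iG]. Qed.

Lemma inner_sadj (V : finType) (C : {set V}) (G : {set V * V}) :
  inner C G -> subrel (fun u v => joined G (u, v)) (sadj C G).
Proof.
by move=> iG u v /orP[] uvG; rewrite /sadj uvG ?orbT; case/andP: (iG _ uvG) => /= -> ->.
Qed.

Lemma cyc_setD1_conn (V : finType) (C : {set V}) (G : {set V * V}) (e : V * V)
    (x y : V) (s : seq V) :
    inner C G -> conn C G -> is_cyc G [:: x, y & s] -> e = (x, y) \/ e = (y, x) ->
  conn C (G :\ e).
Proof.
move=> iG cG cyc exy; have ps := cyc_tail cyc exy.
have ps' := sub_path (inner_sadj (innerD1 (e := e) iG)) ps.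
have yx : connect (sadj C (G :\ e)) y x.
  by apply/connectP; exists (rcons s x); rewrite ?last_rcons.
apply: conn_setD1 => //; case: exy yx => -> yx //=.
by rewrite (sym_connect_sym (@sadj_sym _ _ _)).
Qed.

Lemma cyc_set_conn (V : finType) (C : {set V}) (G : {set V * V}) (e : V * V)
    (c : seq V) :
  inner C G -> conn C G -> is_cyc G c -> e \in cyc_set G c -> conn C (G :\ e).
Proof.
move=> iG cG cyc; case: e => a b; rewrite inE /= => /andP[_].
have sz : (1 < size c)%N by case/and3P: cyc => _ /ltnW.
case/orP => /(cyc_pairs_rot sz)[n [s rc]].
  by apply: (@cyc_setD1_conn _ _ _ _ a b s) => //; [rewrite -rc is_cyc_rot|left].
by apply: (@cyc_setD1_conn _ _ _ _ b a s) => //; [rewrite -rc is_cyc_rot|right].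
Qed.

(* If an arc [e] of [c] were missing from [c'], then removing [e] and an arc of
   [c'] would leave [C] connected with only [#|C| - 2] arcs. *)
Lemma cyc_set_subset (V : finType) (C : {set V}) (G : {set V * V}) (c c' : seq V) :
    inner C G -> conn C G -> (#|G| <= #|C|)%N -> is_cyc G c -> is_cyc G c' ->
  cyc_set G c \subset cyc_set G c'.
Proof.
move=> iG cG GC cyc cyc'; apply/subsetP => e ec; apply/negP => /negP ec'.
have eG : e \in G by move: ec; rewrite inE => /andP[].
have cG1 := cyc_set_conn iG cG cyc ec.
have {}cyc' : is_cyc (G :\ e) c'.
  case/and3P: cyc' => uc sc jc; apply/and3P; split=> //; apply/allP => -[a b] abc.
  have /= jab := allP jc _ abc; apply: joined_setD1 => //;
    by apply: contraNneq ec' => eqe; rewrite inE eG eqe /= abc ?orbT.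
have [e' e'c] : exists e', e' \in cyc_set (G :\ e) c'.
  case: c' cyc' {ec'} => [|x [|y s]] // /and3P[_ _].
  rewrite cyc_pairs_cons /= => /andP[/orP[] xy _].
    by exists (x, y); rewrite inE xy cyc_pairs_cons /= inE eqxx.
  by exists (y, x); rewrite inE xy cyc_pairs_cons /= !inE eqxx !orbT.
have cG2 := cyc_set_conn (innerD1 iG) cG1 cyc' e'c.
have e'G : e' \in G :\ e by move: e'c; rewrite inE => /andP[].
have := leq_trans GC (conn_card cG2).
by rewrite (cardsD1 e G) eG (cardsD1 e' (G :\ e)) e'G !add1n ltnn.
Qed.

(** A spanning tree has [#|C| - 1] arcs, so some arc lies outside it; a simple path joining its ends
    without it closes up to a cycle. *)
Lemma cyc_exists (V : finType) (C : {set V}) (G : {set V * V}) (r : V) :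
    oriented G -> inner C G -> conn C G -> (#|C| <= #|G|)%N -> r \in C ->
  exists c, is_cyc G c.
Proof.
move=> [noloop noopp] iG cG CG rC; have [d [p [q sp]]] := conn_spanning cG rC.
have [[a b] abG abq] : exists2 e, e \in G & e \notin q @: (C :\ r).
  apply/subsetPn/negP => /subset_leq_card; rewrite (card_in_imset (spanning_inj sp)).
  by move/(leq_trans CG); rewrite (cardsD1 r C) rC add1n ltnn.
have cG1 : conn C (G :\ (a, b)).
  apply: (spanning_conn sp) => // u uC; rewrite !inE; have [_ _ -> _] := sp _ uC.
  by rewrite andbT; apply: contraNneq abq => <-; apply: imset_f.
have /andP[/= aC bC] := iG _ abG.
have /connectP[s0 ps0 eqb0] := cG1 _ _ aC bC.
case: (shortenP ps0) eqb0 => s ps us _ eqb {s0 ps0}; exists (a :: s).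
rewrite is_cycE us /= rcons_path -eqb /joined abG orbT andbT.
apply/andP; split; last first.
  apply: sub_path ps => u v /and3P[_ _]; rewrite !inE.
  by case/orP => /andP[_ ->]; rewrite ?orbT.
case: s ps {us} eqb => [|z [|z' s]] //=.
  by move=> _ eqb; rewrite eqb (negPf (noloop _)) in abG.
move=> /andP[/and3P[_ _ az] _] eqb; move: az; rewrite -eqb !inE eqxx /= => /andP[_].
by move/noopp; rewrite abG.
Qed.

Lemma is_cyc_size (V : finType) (F : {set V * V}) (c : seq V) :
  is_cyc F c -> (size c < #|V|.+1)%N.
Proof. by rewrite ltnS => /and3P[/card_uniqP <- _ _]; apply: max_card. Qed.

Lemma mem_cycle_sets (V : finType) (G : {set V * V}) (S : {set V * V}) :
  reflect (exists2 c, is_cyc G c & S = cyc_set G c) (S \in cycle_sets G).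
Proof.
rewrite inE; apply: (iffP existsP) => [[k /existsP[t /andP[ct /eqP ->]]]|[c cc ->]].
  by exists t.
exists (Ordinal (is_cyc_size cc)); apply/existsP; exists (in_tuple c); rewrite /= cc; exact/eqP.
Qed.

Lemma card_cycle_sets (V : finType) (C : {set V}) (G : {set V * V}) (r : V) :
    oriented G -> inner C G -> conn C G -> #|C| = #|G| -> r \in C ->
  #|cycle_sets G| = 1%N.
Proof.
move=> oG iG cG CG rC; have [|c cc] := cyc_exists oG iG cG _ rC; first by rewrite CG.
apply/eqP/cards1P; exists (cyc_set G c); apply/setP=> S; rewrite in_set1.
apply/mem_cycle_sets/eqP => [[c' cc' ->]|->]; last by exists c.
by apply/eqP; rewrite eqEsubset !(@cyc_set_subset _ C) // CG.
Qed.

(** * Incidence matrices *)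

(* The weighted incidence matrix; its columns are scaled so that the product
   with its conjugate transpose is the matrix [Lw]. *)
Definition incid (V : finType) (R : realType) (w : R[i]) (u : V) (e : V * V) : R[i] :=
  if u == e.1 then 1 else if u == e.2 then - conjc w else 0.

Lemma sum_delta (K : nzRingType) (I : finType) (Q : {set I}) (a : I) (f : I -> K) :
  a \in Q -> \sum_(e in Q) (e == a)%:R * f e = f a.
Proof.
move=> aQ; rewrite (bigD1 a) //= eqxx mul1r big1 ?addr0 // => e /andP[_ /negPf->].
by rewrite mul0r.
Qed.

Lemma sum_delta0 (K : nzRingType) (I : finType) (Q : {set I}) (a : I) (f : I -> K) :
  a \notin Q -> \sum_(e in Q) (e == a)%:R * f e = 0.
Proof.
move=> aQ; rewrite big1 // => e eQ; have [ea|_] := eqVneq e a; last by rewrite mul0r.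
by rewrite -ea eQ in aQ.
Qed.

Lemma minor_det_conj_tr (V : finType) (R : realType) (C : {set V}) (M : V -> V -> R[i]) :
  minor_det C (fun x y => conjc (M y x)) = conjc (minor_det C M).
Proof.
rewrite /minor_det -det_map_mx -det_tr; congr (\det _).
by apply/matrixP=> i j; rewrite !mxE.
Qed.

Lemma incid_unit (V : finType) (R : realType) (w : R[i]) (u : V) (e : V * V) :
    w * conjc w = 1 -> (e.1 == u) || (e.2 == u) ->
  incid w u e * conjc (incid w u e) = 1.
Proof.
move=> w1; rewrite /incid ![_ == u]eq_sym; case: eqP => _ /=.
  by rewrite rmorph1 mulr1.
by move=> ->; rewrite rmorphN /= conjcK mulrNN mulrC.
Qed.

(** Only an arc joining [u] and [v] contributes; the Kronecker form lets [sum_delta] read off the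
    entry of [Lw]. *)
Lemma incid_neq (V : finType) (R : realType) (w : R[i]) (u v : V) (e : V * V) :
    u != v ->
  incid w u e * conjc (incid w v e) =
    (e == (u, v))%:R * - w + (e == (v, u))%:R * - conjc w.
Proof.
case: e => x y uv; rewrite /incid !xpair_eqE /= ![_ == u]eq_sym ![_ == v]eq_sym.
have [eux|] := eqVneq u x; [subst x; rewrite [v == u]eq_sym (negPf uv)|].
  case: eqP => _; rewrite /= !(mul1r, mul0r, addr0, rmorphN, rmorph0) //=.
  by rewrite conjcK.
move=> _; have [euy|] := eqVneq u y; [subst y|].
  case: eqP => _; rewrite /= ?[v == u]eq_sym ?(negPf uv) ?(rmorph0, rmorph1) /=;
  by rewrite !(mulr1, mul1r, mulr0, mul0r, add0r).
by rewrite !mul0r ?andbF mul0r addr0.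
Qed.

Lemma Lw_incid (V : finType) (R : realType) (w : R[i]) (E : {set V * V}) (u v : V) :
    oriented E -> w * conjc w = 1 ->
  Lw E w u v = \sum_(e in E) incid w u e * conjc (incid w v e).
Proof.
move=> [_ noopp] w1; rewrite /Lw; have [<-|uv] := eqVneq u v.
  rewrite -sum1_card natr_sum big_mkcond [RHS]big_mkcond /=; apply: eq_bigr => e _.
  rewrite inE; case: (e \in E) => //=; case: ifP => eu; first by rewrite incid_unit.
  by move: eu; rewrite /incid ![_ == u]eq_sym; do 2 case: eqP => _ //=; rewrite mul0r.
under eq_bigr => e _ do rewrite incid_neq //.
rewrite big_split /=; have [uvE|uvE] := boolP ((u, v) \in E).
  by rewrite sum_delta // sum_delta0 ?addr0 // noopp.
rewrite sum_delta0 // add0r; have [vuE|vuE] := boolP ((v, u) \in E).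
  by rewrite sum_delta.
by rewrite sum_delta0.
Qed.

Lemma sum_card_imset (V : finType) (K : nzRingType) (I : finType) (C : {set V}) (G : {set I})
    (q : V -> I) (f : I -> K) :
    {in C &, injective q} -> {in C, forall u, q u \in G} -> #|C| = #|G| ->
  \sum_(e in G) f e = \sum_(u in C) f (q u).
Proof.
move=> q_inj qG CG; rewrite -(big_imset f q_inj); apply: eq_bigl => e.
suff -> : q @: C = G by [].
apply/eqP; rewrite eqEcard card_in_imset // CG leqnn andbT.
by apply/subsetP => _ /imsetP[u /qG ? ->].
Qed.

(** [q] is a bijection from [C] onto [G], so indexing columns by vertices makes the incidence matrix
    square and the determinant multiplicative. *)
Lemma minor_det_Lw (V : finType) (R : realType) (w : R[i]) (C : {set V}) (G : {set V * V})
    (q : V -> V * V) :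
    oriented G -> w * conjc w = 1 ->
    {in C &, injective q} -> {in C, forall u, q u \in G} -> #|C| = #|G| ->
  let D := minor_det C (fun u v => incid w u (q v)) in
  minor_det C (Lw G w) = D * conjc D.
Proof.
move=> oG w1 q_inj qG CG /=; rewrite -minor_det_conj_tr -minor_det_mul.
apply: eq_minor_det => u v _ _; rewrite Lw_incid //.
exact: (sum_card_imset (fun e => incid w u e * conjc (incid w v e)) q_inj qG CG).
Qed.

(** The column of [v != r] is supported on [v] and its parent, where [d] is smaller, so [M] is
    triangular. Its diagonal entries other than [c] have modulus one, hence only the squared modulus
    is determined. *)
Lemma spanning_det (V : finType) (R : realType) (w c : R[i]) (C : {set V}) (G : {set V * V})
    (r : V) d p q (M : V -> V -> R[i]) :
    w * conjc w = 1 -> spanning C G r d p q -> r \in C ->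
    {in C, forall u, M u r = c * (u == r)%:R} ->
    {in C & C :\ r, forall u v, M u v = incid w u (q v)} ->
  minor_det C M * conjc (minor_det C M) = c * conjc c.
Proof.
move=> w1 sp rC Mr Mq; rewrite (minor_det_trig (d := d)); last first.
  move=> x y xC yC xy; have [yr|yr] := eqVneq y r.
    by move=> _; rewrite yr Mr // -yr (negPf xy) mulr0.
  have yC' : y \in C :\ r by rewrite !inE yr.
  rewrite Mq // leqNgt => /negP dyx; have [_ dlt _ qy] := sp _ yC'.
  have xp : x == p y = false by apply/eqP => xp; apply: dyx; rewrite xp.
  by case: qy => ->; rewrite /incid /= xp (negPf xy).
rewrite (big_setD1 r) //= Mr // eqxx mulr1 rmorphM rmorph_prod mulrACA -big_split /=.
rewrite big1 ?mulr1 // => v vC'; have [_ _ _ qv] := sp _ vC'.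
move: (vC'); rewrite !inE => /andP[_ vC]; rewrite Mq // incid_unit //.
by case: qv => ->; rewrite eqxx ?orbT.
Qed.

(** The unit [c] rescales the column of the arc so that the entry at the start [v] is 1 whichever
    way the arc points: [c] is 1 for an arc out of [v] and [- w] for an arc into [v]. *)
Lemma joined_step (V : finType) (R : realType) (w : R[i]) (G G1 : {set V * V}) (v z : V) :
    oriented G -> w * conjc w = 1 -> G1 \subset G -> joined G1 (v, z) ->
  exists e (c : R[i]), [/\ e \in G1, e = (v, z) \/ e = (z, v), c * conjc c = 1 &
    forall u, incid w u e * c =
      (u == v)%:R - (if (v, z) \in G then conjc w else w) * (u == z)%:R].
Proof.
move=> [noloop noopp] w1 sG vz; have vz_neq : v != z.
  apply: contraTneq vz => ->; rewrite /joined /= orbb; apply/negP => /(subsetP sG).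
  by rewrite (negPf (noloop z)).
case: ifP => vzG.
  exists (v, z), 1; split.
  - case/orP: vz => // /= /(subsetP sG) zvG; by rewrite (negPf (noopp _ _ zvG)) in vzG.
  - by left.
  - by rewrite rmorph1 mulr1.
  - move=> u; rewrite /incid /= mulr1; have [->|_] := eqVneq u v.
      by rewrite (negPf vz_neq) mulr0 subr0.
    by case: eqP => _; rewrite ?mulr1 ?mulr0 ?sub0r ?oppr0.
exists (z, v), (- w); split.
- by case/orP: vz => // /(subsetP sG); rewrite vzG.
- by right.
- by rewrite rmorphN /= mulrNN.
- move=> u; rewrite /incid /=; have [->|_] := eqVneq u z.
    by rewrite [z == v]eq_sym (negPf vz_neq) sub0r mul1r mulr1.
  by rewrite mulr0 subr0; case: eqP => _; rewrite ?mul0r // mulrNN mulrC.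
Qed.

(* Telescoping along the path: every arc contributes the indicator of its
   start minus a unit times the indicator of its end. *)
Lemma path_potential (V : finType) (R : realType) (w : R[i]) (G G1 : {set V * V})
    (v : V) (s : seq V) :
    oriented G -> w * conjc w = 1 -> G1 \subset G ->
    path (fun a b => joined G1 (a, b)) v s ->
  exists Y : V * V -> R[i], forall u, \sum_(e in G1) incid w u e * Y e =
    (u == v)%:R - (\prod_(a <- pairmap pair v s) (if a \in G then conjc w else w)) *
                  (u == last v s)%:R.
Proof.
move=> oG w1 sG; elim: s v => [|z s IH] v /=.
  move=> _; exists (fun=> 0) => u; rewrite big_nil mul1r subrr big1 // => e _.
  by rewrite mulr0.
case/andP=> vz /IH[Y' eqY']; have [e [c [eG1 _ _ eqc]]] := joined_step oG w1 sG vz.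
set t := if _ then _ else _ in eqc.
exists (fun e' => (e' == e)%:R * c + t * Y' e') => u.
under eq_bigr => e' _ do rewrite mulrDr mulrCA [incid _ _ _ * (t * _)]mulrCA.
rewrite big_split /= (sum_delta (fun e' => incid w u e' * c)) // -mulr_sumr eqY' eqc.
by rewrite big_cons -/t; ring.
Qed.

Lemma prod_count (K : comNzRingType) (T : Type) (P : pred T) (a b : K) (s : seq T) :
  \prod_(x <- s) (if P x then a else b) = a ^+ count P s * b ^+ (size s - count P s).
Proof.
have -> : (size s - count P s)%N = count (predC P) s by rewrite -(count_predC P) addKn.
elim: s => [|x s IH]; first by rewrite big_nil mulr1.
by rewrite big_cons IH /=; case: (P x); rewrite /= ?add0n exprS; ring.
Qed.

(** With the tree rooted at the inner end [r] of [e], the column of [e] restricted to [C] is a unit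
    times the indicator of [r]. *)
Lemma minor_det_dangling (V : finType) (R : realType) (w : R[i]) (C : {set V})
    (G : {set V * V}) (e : V * V) (r : V) :
    oriented G -> w * conjc w = 1 -> conn C G -> #|C| = #|G| -> e \in G -> r \in C ->
    (e.1 == r) && (e.2 \notin C) || (e.2 == r) && (e.1 \notin C) ->
  minor_det C (Lw G w) = 1.
Proof.
move=> oG w1 cG CG eG rC er; have [d [p [q sp]]] := conn_spanning cG rC.
pose q' u := if u == r then e else q u.
have q'r : q' r = e by rewrite /q' eqxx.
have q'q u : u != r -> q' u = q u by rewrite /q' => /negPf->.
(* Tree arcs have both ends in [C], unlike [e]. *)
have qe u : u \in C :\ r -> q u != e.
  move=> uC; have [pC _ _ qu] := sp _ uC; move: uC; rewrite !inE => /andP[_ uC].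
  apply: contraTneq er => <-.
  by case: qu => -> /=; rewrite uC pC !andbF.
have [q'_inj q'G] : {in C &, injective q'} /\ {in C, forall u, q' u \in G} :=
  spanning_extend sp (subxx G) eG qe.
rewrite (minor_det_Lw oG w1 q'_inj q'G CG) /=.
rewrite (@spanning_det _ _ _ (incid w r e) _ _ _ _ _ _ _ w1 sp rC).
- by rewrite incid_unit //; case/orP: er => /andP[-> _]; rewrite ?orbT.
- move=> u uC; rewrite q'r; have [->|ur] := eqVneq u r; first by rewrite mulr1.
  rewrite mulr0 /incid.
  by case/orP: er => /andP[/eqP e1 e2]; rewrite e1 (negPf ur);
    case: eqP => // equ; rewrite -equ uC in e2.
- by move=> u v uC; rewrite !inE => /andP[vr _]; rewrite q'q.
Qed.

(** The tree lives in [G :\ e], with [e] assigned to the root [x]. The column of [e] is traded for a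
    combination of all columns; the determinant of this operation is a unit, so the modulus is
    unchanged. *)
Lemma minor_det_cyc (V : finType) (R : realType) (w : R[i]) (C : {set V})
    (G : {set V * V}) (c : seq V) :
    oriented G -> w * conjc w = 1 -> inner C G -> conn C G -> #|C| = #|G| ->
    is_cyc G c ->
  let P := \prod_(a <- cyc_pairs c) (if a \in G then conjc w else w) in
  minor_det C (Lw G w) = (1 - P) * conjc (1 - P).
Proof.
move=> oG w1 iG cG CG; case: c => [|x [|y s]] // cyc P.
have xy : joined G (x, y).
  by case/and3P: cyc => _ _; rewrite cyc_pairs_cons /= => /andP[].
have [e [c [eG exy c1 eqc]]] := joined_step oG w1 (subxx G) xy.
have cG1 := cyc_setD1_conn iG cG cyc exy.
have [Y0 eqY0] := path_potential oG w1 (subD1set G e) (cyc_tail cyc exy).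
set t := if _ then _ else _ in eqc.
(* The arc [e] carries the indicator of [x] to [t] times that of [y]; the potential of the remaining
   path, scaled by [t], carries it on to [P] at [x]. *)
pose Y a := if a == e then c else t * Y0 a.
have eqY u : \sum_(a in G) incid w u a * Y a = (1 - P) * (u == x)%:R.
  rewrite (big_setD1 e) //= {1}/Y eqxx eqc.
  have -> : \sum_(a in G :\ e) incid w u a * Y a = t * \sum_(a in G :\ e) incid w u a * Y0 a.
    rewrite mulr_sumr; apply: eq_bigr => a; rewrite !inE => /andP[/negPf ae _].
    by rewrite /Y ae mulrCA.
  rewrite eqY0 last_rcons /P cyc_pairs_cons /= big_cons -/t.
  by move: (\prod_(_ <- _) _) => Q; ring.
have xC : x \in C.
  by have := inner_sadj iG xy; case/and3P.
have [d [p [q sp]]] := conn_spanning cG1 xC.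
pose q' u := if u == x then e else q u.
have q'x : q' x = e by rewrite /q' eqxx.
have q'q u : u != x -> q' u = q u by rewrite /q' => /negPf->.
have qe : {in C :\ x, forall u, q u != e}.
  by move=> u uC; have [_ _ /setD1P[]] := sp _ uC.
have [q'_inj q'G] : {in C &, injective q'} /\ {in C, forall u, q' u \in G} :=
  spanning_extend sp (subD1set G e) eG qe.
rewrite (minor_det_Lw oG w1 q'_inj q'G CG) /=; set D := minor_det _ _.
(* The matrix of the column operation: the identity except in column [x], which holds the
   coefficients [Y]. *)
pose X z v : R[i] := if v == x then Y (q' z) else (z == v)%:R.
have detX : minor_det C X = c.
  rewrite (minor_det_trig (d := fun z => (z == x) : nat)); last first.
    move=> u v uC vC uv; rewrite /X; case: (eqVneq v x) => [vx|_ _]; last by rewrite (negPf uv).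
    by rewrite vx in uv *; rewrite (negPf uv).
  rewrite (big_setD1 x) //= {1}/X eqxx q'x /Y eqxx big1 ?mulr1 // => u.
  by rewrite !inE => /andP[/negPf ux _]; rewrite /X ux eqxx.
have eqM := minor_det_mul C (fun u v => incid w u (q' v)) X.
rewrite detX -/D in eqM.
have := @spanning_det _ _ w (1 - P) _ _ _ _ _ _
  (fun u v => \sum_(z in C) incid w u (q' z) * X z v) w1 sp xC.
rewrite eqM rmorphM /= mulrACA c1 mulr1; apply.
- move=> u uC; rewrite -eqY (sum_card_imset (fun a => incid w u a * Y a) q'_inj q'G CG).
  by apply: eq_bigr => z _; rewrite /X eqxx.
- move=> u v uC; rewrite !inE => /andP[vx vC]; rewrite -(q'q v) //.
  rewrite (bigD1 v) //= /X (negPf vx) eqxx mulr1 big1 ?addr0 // => z /andP[_ /negPf->].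
  by rewrite mulr0.
Qed.

(** With [f] forward arcs out of [k], the product is [conjc w ^+ f * w ^+ (k - f)]. Cancellation
    leaves the power [k - 2g] of [w] or of [conjc w], and both give the same squared modulus. *)
Lemma minor_det_cyc_val (V : finType) (R : realType) (w : R[i]) (C : {set V})
    (G : {set V * V}) (c : seq V) :
    oriented G -> w * conjc w = 1 -> inner C G -> conn C G -> #|C| = #|G| ->
    is_cyc G c ->
  minor_det C (Lw G w) = 2 - w ^+ cyc_val G c - conjc w ^+ cyc_val G c.
Proof.
move=> oG w1 iG cG CG cyc; rewrite (minor_det_cyc oG w1 iG cG CG cyc) /=.
rewrite (prod_count (mem G)) -/(n_fwd G c).
have sz : size (cyc_pairs c) = size c by rewrite size_zip size_rot minnn.
rewrite sz /cyc_val; move: (count_size (mem G) (cyc_pairs c)); rewrite sz -/(n_fwd G c).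
move: (size c) (n_fwd G c) => k f lefk.
have wX n : w ^+ n * conjc w ^+ n = 1 by rewrite -exprMn w1 expr1n.
have [lefg|ltgf] := leqP f (k - f).
  set v := (k - 2 * f)%N; have -> : (k - f = f + v)%N by rewrite /v; lia.
  rewrite exprD mulrA [conjc w ^+ f * _]mulrC wX mul1r.
  rewrite rmorphB rmorphXn /= rmorph1.
  have -> : (1 - w ^+ v) * (1 - conjc w ^+ v) =
    1 - w ^+ v - conjc w ^+ v + w ^+ v * conjc w ^+ v by ring.
  by rewrite wX; ring.
set g := (k - f)%N; set v := (k - 2 * g)%N.
have -> : f = (v + g)%N by rewrite /v /g; lia.
rewrite exprD -mulrA [conjc w ^+ g * _]mulrC wX mulr1.
rewrite rmorphB rmorphXn /= rmorph1 conjcK.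
have -> : (1 - conjc w ^+ v) * (1 - w ^+ v) =
  1 - w ^+ v - conjc w ^+ v + w ^+ v * conjc w ^+ v by ring.
by rewrite wX; ring.
Qed.

(** * Fifth roots of unity and the determinant formula *)

Lemma cos_sin_expr (R : realType) (x : R) (n : nat) :
  (Complex (cos x) (sin x)) ^+ n = Complex (cos (x *+ n)) (sin (x *+ n)).
Proof.
elim: n => [|n IH]; first by rewrite mulr0n cos0 sin0.
rewrite exprS IH mulrS cosD sinD.
by apply/eqP; rewrite eq_complex /= eqxx /= addrC.
Qed.

Lemma omega5_unit (R : realType) : omega5 R * conjc (omega5 R) = 1.
Proof.
apply/eqP; rewrite eq_complex /=; apply/andP; split; apply/eqP; last by ring.
by rewrite mulrN opprK -!expr2 cos2Dsin2.
Qed.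

Lemma omega5_expr5 (R : realType) : omega5 R ^+ 5 = 1.
Proof.
rewrite cos_sin_expr; have -> : (2 * pi / 5) *+ 5 = pi *+ 2 :> R.
  by rewrite -mulr_natr -[RHS]mulr_natr; field.
by rewrite cos2pi sin2pi.
Qed.

Lemma sqrt5_sqr (R : realType) : sqrt5 R * sqrt5 R = 5.
Proof.
rewrite /sqrt5 -rmorphM -expr2 sqr_sqrtr ?ler0n //; exact: rmorph_nat.
Qed.

(** The trace is a root of [a ^+ 2 + a - 1], and the sign of the cosine selects the positive
    root. *)
Lemma omega5_trace (R : realType) :
  omega5 R + conjc (omega5 R) = (sqrt5 R - 1) / 2.
Proof.
set w := omega5 R; set a := w + _; have w1 := omega5_unit R; rewrite -/w in w1.
have pi0 := pi_gt0 R.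
have wn1 : w - 1 != 0.
  rewrite subr_eq0 eq_complex /= negb_and orbC gt_eqF //.
  by apply: sin_gt0_pi; apply/andP; split; lra.
have aE : a ^+ 2 + a - 1 = 0.
  apply: (mulfI wn1); rewrite mulr0.
  have eqc : conjc w = w ^+ 4.
    by rewrite -[LHS]mul1r -(omega5_expr5 R) -/w exprSr -mulrA w1 mulr1.
  (* With [a = w + w ^+ 4] the quadratic is the fifth cyclotomic polynomial plus
     [(w ^+ 5 - 1) * (2 + w ^+ 3)]; multiplying by [w - 1] exposes the factor [w ^+ 5 - 1]. *)
  rewrite /a eqc; transitivity ((w ^+ 5 - 1) * (1 + (w - 1) * (2 + w ^+ 3))); first by ring.
  by rewrite omega5_expr5 subrr mul0r.
pose b : R := 2 * cos (2 * pi / 5).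
have aR : a = b%:C%C.
  by apply/eqP; rewrite eq_complex /= subrr eqxx andbT; apply/eqP; rewrite /b; ring.
have b0 : 0 < b.
  by rewrite mulr_gt0 //; apply: cos_gt0_pihalf; apply/andP; split; lra.
clearbody b; have bE : b ^+ 2 + b - 1 = 0.
  apply: (@complexI R); rewrite rmorph0 -aE aR rmorphB rmorphD rmorphXn rmorph1 //.
have b5 : Num.sqrt 5 = 2 * b + 1.
  have -> : 5 = (2 * b + 1) ^+ 2 by lra.
  by rewrite sqrtr_sqr ger0_norm //; lra.
by rewrite aR /sqrt5 b5 rmorphD rmorphM rmorph1 rmorph_nat; field.
Qed.

Lemma phi_gold_mul (R : realType) : phi_gold R * ((sqrt5 R - 1) / 2) = 1.
Proof.
rewrite /phi_gold; move: (sqrt5 R) (sqrt5_sqr R) => s ss.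
have -> : (1 + s) / 2 * ((s - 1) / 2) = (s * s - 1) / 4 by field.
by rewrite ss; field.
Qed.

Lemma phi_gold_neq0 (R : realType) : phi_gold R != 0.
Proof.
by apply/eqP => p0; have /eqP := phi_gold_mul R; rewrite p0 mul0r eq_sym oner_eq0.
Qed.

(** Exponents are reduced modulo 5, and inversion pairs 1 with 4 and 2 with 3. The value for 1 comes
    from the trace, the one for 2 from its square. *)
Lemma omega5_weight (R : realType) (n : nat) (s := sqrt5 R) (phi := phi_gold R)
    (W := 2 - omega5 R ^+ n - conjc (omega5 R) ^+ n) :
  [/\ (n %% 5 \in [:: 2; 3])%N -> W = s * phi,
      (n %% 5 \in [:: 1; 4])%N -> W = s / phi &
      (n %% 5 \in [:: 0])%N -> W = 0].
Proof.
have w1 := omega5_unit R; have w5 := omega5_expr5 R; have tr := omega5_trace R.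
have ss := sqrt5_sqr R; rewrite -/s in tr ss.
have c5 : conjc (omega5 R) ^+ 5 = 1 by rewrite -rmorphXn w5 rmorph1.
have phiV : phi^-1 = (s - 1) / 2.
  exact: mulr1_eq (phi_gold_mul R).
rewrite {}/W -(expr_mod n w5) -(expr_mod n c5); move: w1 w5 c5 tr.
move: (omega5 R) (conjc (omega5 R)) => w z w1 w5 c5 tr.
have w4 : w ^+ 4 = z by rewrite -[RHS]mul1r -w5 (exprSr w 4) -mulrA w1 mulr1.
have z4 : z ^+ 4 = w by rewrite -[RHS]mulr1 -c5 (exprS z 4) mulrA w1 mul1r.
have w3 : w ^+ 3 = z ^+ 2.
  by rewrite -[RHS]mul1r -w5 (exprD w 3 2) -mulrA -exprMn w1 expr1n mulr1.
have z3 : z ^+ 3 = w ^+ 2.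
  by rewrite -[RHS]mulr1 -c5 (exprD z 2 3) mulrA -exprMn w1 expr1n mul1r.
have W1 : 2 - w - z = s / phi.
  rewrite phiV; have -> : 2 - w - z = 2 - (w + z) by ring.
  rewrite tr; have -> : s * ((s - 1) / 2) = (s * s - s) / 2 by field.
  by rewrite ss; field.
have W2 : 2 - w ^+ 2 - z ^+ 2 = s * phi.
  have -> : 2 - w ^+ 2 - z ^+ 2 = 2 + 2 * (w * z) - (w + z) * (w + z) by ring.
  rewrite w1 tr /phi /phi_gold -/s.
  have -> : s * ((1 + s) / 2) = (s + s * s) / 2 by field.
  have -> : (s - 1) / 2 * ((s - 1) / 2) = (s * s - 2 * s + 1) / 4 by field.
  by rewrite ss; field.
split; rewrite !inE => /=.
- case/orP=> /eqP->; first exact: W2.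
  by rewrite w3 z3 -W2; ring.
- case/orP=> /eqP->; first by rewrite !expr1.
  by rewrite w4 z4 -W1; ring.
- by move/eqP->; rewrite !expr0; ring.
Qed.

Lemma oriented_sub (V : finType) (E F : {set V * V}) :
  oriented E -> F \subset E -> oriented F.
Proof.
move=> [noloop noopp] /subsetP FE; split=> [u|u v uv].
  by apply: contra (noloop u); apply: FE.
by apply: contra (noopp u v (FE _ uv)); apply: FE.
Qed.

Lemma comp_arcs_sub (V : finType) (F : {set V * V}) (C : {set V}) : comp_arcs F C \subset F.
Proof. by apply/subsetP => e; rewrite inE => /andP[]. Qed.

(** Diagonal entries agree because [comp_arcs] keeps every arc touching [C], including those leaving
    it. *)
Lemma Lw_comp_arcs (V : finType) (R : realType) (w : R[i]) (F : {set V * V}) (C : {set V}) :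
  {in C &, forall u v, Lw F w u v = Lw (comp_arcs F C) w u v}.
Proof.
move=> u v uC vC; rewrite /Lw !inE /= uC vC /= !andbT.
case: eqP => // _; congr (_%:R); apply: eq_card => e; rewrite !inE.
case: (e \in F) => //=; case: eqP => [->|_] /=; first by rewrite uC.
by case: eqP => [->|_]; rewrite ?uC ?orbT ?andbF.
Qed.

(** * The block of one regular component *)

Section Component.
Variables (V : finType) (R : realType) (V' : {set V}) (F : {set V * V}) (C : {set V}).
Hypotheses (oF : oriented F) (CP : C \in comps V' F) (CF : #|C| = #|comp_arcs F C|).

Let W := minor_det C (Lw F (omega5 R)).

(** [cyc_class] only provides some cycle with the right residue, which suffices since the
    determinant formula holds for any cycle. *)
Lemma comp_cyc_class (r : seq nat) : cyc_class F C r ->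
  exists2 n, (n %% 5 \in r)%N & W = 2 - omega5 R ^+ n - conjc (omega5 R) ^+ n.
Proof.
case/andP=> /andP[/forallP iG _] /existsP[k /existsP[t /andP[cyc rt]]].
exists (cyc_val (comp_arcs F C) t) => //.
rewrite /W (eq_minor_det (@Lw_comp_arcs _ _ _ F C)); apply: minor_det_cyc_val => //.
- exact: oriented_sub (comp_arcs_sub F C).
- exact: omega5_unit.
- by move=> e eG; apply: (implyP (iG e)).
- exact: comps_conn CP.
Qed.

Lemma alpha_det : alpha_comp F C -> W = sqrt5 R * phi_gold R.
Proof. by case/comp_cyc_class=> n rn ->; have [/(_ rn)] := omega5_weight R n. Qed.

Lemma beta_det : beta_comp F C -> W = sqrt5 R / phi_gold R.
Proof. by case/comp_cyc_class=> n rn ->; have [_ /(_ rn)] := omega5_weight R n. Qed.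

Lemma vanishing_det : vanishing_comp F C -> W = 0.
Proof. by case/comp_cyc_class=> n rn ->; have [_ _ /(_ rn)] := omega5_weight R n. Qed.

(** If all arcs were inner, the component would be unicyclic and its residue modulo 5 would put it
    in one of the three classes. So some arc leaves [C] and the dangling case applies. *)
Lemma other_det :
  ~~ alpha_comp F C -> ~~ beta_comp F C -> ~~ vanishing_comp F C -> W = 1.
Proof.
have oG := oriented_sub oF (comp_arcs_sub F C).
have cG := comps_conn CP; move=> nalpha nbeta nvan.
have [x xC] : exists x, x \in C.
  by case/imsetP: (CP) => x _ ->; exists x; rewrite inE connect0.
have [/forallP iG|] := boolP [forall e in comp_arcs F C, (e.1 \in C) && (e.2 \in C)].
  have {}iG : inner C (comp_arcs F C) by move=> e eG; apply: (implyP (iG e)).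
  have [|c cc] := cyc_exists oG iG cG _ xC; first by rewrite CF.
  have uF : unicyclic F C.
    apply/andP; split; last by rewrite (card_cycle_sets oG iG cG CF xC).
    by apply/forallP => e; apply/implyP => /iG.
  have cls r : (cyc_val (comp_arcs F C) c %% 5 \in r)%N -> cyc_class F C r.
    move=> rc; rewrite /cyc_class uF; apply/existsP; exists (Ordinal (is_cyc_size cc)).
    by apply/existsP; exists (in_tuple c); rewrite /= cc.
  have := contraNN (@cls _) nalpha; have := contraNN (@cls _) nbeta.
  have := contraNN (@cls _) nvan; rewrite !inE.
  have := ltn_pmod (cyc_val (comp_arcs F C) c) (isT : (0 < 5)%N).
  by case: (_ %% _)%N => [|[|[|[|[|]]]]].
rewrite negb_forall => /existsP[e]; rewrite negb_imply => /andP[eG].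
rewrite negb_and /W (eq_minor_det (@Lw_comp_arcs _ _ _ F C)) => eC.
have := eG; rewrite inE => /andP[_ /orP[]] endC.
  apply: (minor_det_dangling oG (omega5_unit R) cG CF eG endC).
  by move: eC; rewrite endC eqxx /= => ->.
apply: (minor_det_dangling oG (omega5_unit R) cG CF eG endC).
by move: eC; rewrite endC eqxx orbF /= => ->; rewrite orbT.
Qed.

End Component.

(** * Summing over arc sets and factoring over components *)

Lemma minor_det_card_lt (V : finType) (R : realType) (w : R[i]) (C : {set V})
    (G : {set V * V}) :
    oriented G -> w * conjc w = 1 -> (#|G| < #|C|)%N -> minor_det C (Lw G w) = 0.
Proof.
move=> oG w1 GC.
rewrite (eq_minor_det (M' := fun u v => \sum_(e in G) incid w u e * conjc (incid w v e))).
  rewrite (minor_det_sum_subsets C G (incid w) (fun e v => conjc (incid w v e))) big1 //.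
  move=> F /andP[/subset_leq_card leFG /eqP eqFC].
  by move: GC; rewrite -eqFC ltnNge leFG.
by move=> u v _ _; apply: Lw_incid.
Qed.

Lemma minor_det_Lw_subsets (V : finType) (R : realType) (w : R[i]) (C : {set V})
    (E : {set V * V}) :
    oriented E -> w * conjc w = 1 ->
  minor_det C (Lw E w) =
  \sum_(F : {set V * V} | (F \subset E) && (#|F| == #|C|)) minor_det C (Lw F w).
Proof.
move=> oE w1.
have eqL (F : {set V * V}) : F \subset E -> minor_det C (Lw F w) =
    minor_det C (fun u v => \sum_(e in F) incid w u e * conjc (incid w v e)).
  by move=> FE; apply: eq_minor_det => u v _ _; apply: Lw_incid => //; apply: oriented_sub FE.
rewrite eqL // (minor_det_sum_subsets C E (incid w) (fun e v => conjc (incid w v e))).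
by apply: eq_bigr => F /andP[FE _]; rewrite eqL.
Qed.

Lemma minor_det_comps (V : finType) (R : realType) (w : R[i]) (V' : {set V})
    (F : {set V * V}) :
  minor_det V' (Lw F w) = \prod_(C in comps V' F) minor_det C (Lw F w).
Proof.
have /and3P[/eqP covV tP _] := comps_partition V' F.
rewrite -{1}covV minor_det_partition // => A B AP BP AB x y xA yB.
have xyF : ~~ sadj V' F x y.
  apply/negP => /(comps_closed AP xA) yA; move/trivIsetP: tP => /(_ _ _ AP BP AB).
  by move/disjointFr => /(_ _ yA); rewrite yB.
have xV : x \in V' by rewrite -covV; apply/bigcupP; exists A.
have yV : y \in V' by rewrite -covV; apply/bigcupP; exists B.
move: xyF; rewrite /sadj xV yV negb_or /= => /andP[/negPf xy /negPf yx].
rewrite /Lw xy yx; case: eqP => // eqxy; case/negP: AB; apply/eqP.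
have := trivIsetP tP _ _ AP BP; case: eqVneq => // _ /(_ isT) /disjointFr /(_ xA).
by rewrite eqxy yB.
Qed.

(** The sets [comp_arcs F C] are disjoint, so their sizes add up to at most [#|F| = #|V'|], the sum
    of the [#|C|]. If no component lacked arcs, all these sizes would be equal. *)
Lemma comps_card_lt (V : finType) (V' : {set V}) (F : {set V * V}) :
    #|F| = #|V'| -> ~~ all_regular V' F ->
  exists2 C, C \in comps V' F & (#|comp_arcs F C| < #|C|)%N.
Proof.
move=> FV nreg; have partV := comps_partition V' F.
have /and3P[/eqP covV tP _] := partV.
suff [C /andP[CP Clt]] : exists C, (C \in comps V' F) && (#|comp_arcs F C| < #|C|)%N.
  by exists C.
apply/existsP; apply: contraNT nreg; rewrite negb_exists => /forallP leC.
have {}leC C : C \in comps V' F -> (#|C| <= #|comp_arcs F C|)%N.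
  by move=> CP; have := leC C; rewrite CP /= -leqNgt.
have disj (C D : {set V}) : C \in comps V' F -> D \in comps V' F -> C != D ->
    [disjoint comp_arcs F C & comp_arcs F D].
  move=> CP DP CD; have dCD := trivIsetP tP _ _ CP DP CD.
  have inV (A : {set V}) z : A \in comps V' F -> z \in A -> z \in V'.
    by move=> AP zA; rewrite -covV; apply/bigcupP; exists A.
  rewrite -setI_eq0; apply/eqP/setP => -[a b]; rewrite !inE /=.
  apply/negP => /andP[/andP[abF abC] /andP[_ abD]].
  have sab : a \in V' -> b \in V' -> sadj V' F a b by move=> aV bV; rewrite /sadj aV bV abF.
  have [/orP[aC|bC] /orP[aD|bD]] := (abC, abD).
  - by have := disjointFr dCD aC; rewrite aD.
  - have := disjointFr dCD (comps_closed CP aC (sab (inV _ _ CP aC) (inV _ _ DP bD))).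
    by rewrite bD.
  - have := disjointFr dCD bC; rewrite (comps_closed DP aD) //.
    exact: sab (inV _ _ DP aD) (inV _ _ CP bC).
  - by have := disjointFr dCD bC; rewrite bD.
have sumF : (\sum_(C in comps V' F) #|comp_arcs F C| <= \sum_(C in comps V' F) #|C|)%N.
  rewrite -(card_partition partV) -FV.
  have cardE C : #|comp_arcs F C| = (\sum_(e in F) (e \in comp_arcs F C))%N.
    rewrite -sum1_card big_mkcond [RHS]big_mkcond; apply: eq_bigr => e _.
    by rewrite inE; case: (e \in F) => //=; case: (_ || _).
  under eq_bigr => C _ do rewrite cardE.
  rewrite exchange_big -sum1_card; apply: leq_sum => e _.
  (* An arc with no end in [V'] belongs to no component, hence only an inequality. *)
  have [C /andP[CP eC]|noC] := pickP (fun C => (C \in comps V' F) && (e \in comp_arcs F C)).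
    rewrite (bigD1 C) //= eC big1 // => D /andP[DP DC].
    by rewrite (disjointFl (disj D C DP CP DC) eC).
  by rewrite big1 // => C CP; have := noC C; rewrite CP /= => ->.
apply/forallP => C; apply/implyP => CP; rewrite eqn_leq leC //=.
move: sumF; rewrite (bigD1 C) //= [X in (_ <= X)%N](bigD1 C) //= => sumF.
have leS : (\sum_(D in comps V' F | D != C) #|D| <=
            \sum_(D in comps V' F | D != C) #|comp_arcs F D|)%N.
  by apply: leq_sum => D /andP[/leC].
by rewrite -(leq_add2r (\sum_(D in comps V' F | D != C) #|D|)%N);
  apply: leq_trans sumF; rewrite leq_add2l.
Qed.

Lemma prod_if_const (K : comNzRingType) (T : finType) (A : {set T}) (P : pred T) (x : K) :
  \prod_(C in A) (if P C then x else 1) = x ^+ #|[set C in A | P C]|.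
Proof.
by rewrite -big_mkcondr -prodr_const; apply: eq_bigl => C; rewrite inE.
Qed.

Theorem mainTheorem12 (R : realType) (V : finType) (E : {set V * V})
  (hE : oriented E) (V' : {set V}) :
  \det (Lsub E (omega5 R) V') =
  \sum_(E' : {set V * V} | [&& E' \subset E, #|E'| == #|V'| & all_regular V' E'])
     ((n_zero V' E' == 0%N)%:R *
      sqrt5 R ^+ (n_alpha V' E' + n_beta V' E') *
      phi_gold R ^ ((n_alpha V' E')%:Z - (n_beta V' E')%:Z)).
Proof.
rewrite -[LHS]/(minor_det V' (Lw E (omega5 R))).
rewrite (minor_det_Lw_subsets V' hE (omega5_unit R)).
under eq_bigr => F _ do rewrite minor_det_comps.
rewrite (bigID (all_regular V')) /= [X in _ + X]big1 ?addr0; last first.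
  move=> F /andP[/andP[FE /eqP FV] nreg]; have [C CP ltC] := comps_card_lt FV nreg.
  rewrite (bigD1 C) //= (eq_minor_det (@Lw_comp_arcs _ _ _ F C)).
  rewrite (minor_det_card_lt _ (omega5_unit R) ltC) ?mul0r //.
  exact: oriented_sub (subset_trans (comp_arcs_sub F C) FE).
apply: eq_big => F; first by rewrite andbA.
case/andP=> /andP[FE _] /forallP reg; have oF := oriented_sub hE FE.
have CF C : C \in comps V' F -> #|C| = #|comp_arcs F C|.
  by move=> CP; apply/eqP/(implyP (reg C)).
have s0 : sqrt5 R != 0.
  by apply/eqP => s0; have := sqrt5_sqr R; rewrite s0 mul0r => /esym/eqP; rewrite pnatr_eq0.
have phi0 := phi_gold_neq0 R.
have [/eqP nz|] := boolP (n_zero V' F == 0%N); last first.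
  rewrite cards_eq0 => /set0Pn[C]; rewrite inE => /andP[CP vC].
  by rewrite (bigD1 C) //= (vanishing_det R oF CP (CF C CP)) // !mul0r.
(* The classes are existential over cycles, so disjointness is read off the determinants: [phi]
   differs from its inverse. *)
have excl C : C \in comps V' F -> alpha_comp F C -> ~~ beta_comp F C.
  move=> CP aC; apply/negP => bC.
  have := alpha_det R oF CP (CF C CP) aC;
  rewrite (beta_det R oF CP (CF C CP) bC) => /(mulfI s0).
  rewrite (mulr1_eq (phi_gold_mul R)) /phi_gold => /eqP; rewrite -subr_eq0.
  have -> : (sqrt5 R - 1) / 2 - (1 + sqrt5 R) / 2 = - 1 by field.
  by rewrite oppr_eq0 oner_eq0.
rewrite mul1r.
(* Separating the alpha and beta factors turns each product into a power counted by [n_alpha] or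
   [n_beta]. *)
transitivity (\prod_(C in comps V' F) ((if alpha_comp F C then sqrt5 R * phi_gold R else 1) *
   (if beta_comp F C then sqrt5 R / phi_gold R else 1))).
  apply: eq_bigr => C CP; have CFC := CF C CP.
  have nv : ~~ vanishing_comp F C.
    move/eqP: nz; rewrite cards_eq0 => /eqP/setP/(_ C); rewrite !inE CP /=.
    by move=> ->.
  have [aC|aC] := boolP (alpha_comp F C).
    by rewrite (negPf (excl C CP aC)) mulr1; exact: (alpha_det R oF CP CFC aC).
  have [bC|bC] := boolP (beta_comp F C).
    by rewrite mul1r; exact: (beta_det R oF CP CFC bC).
  by rewrite mul1r; exact: (other_det R oF CP CFC aC bC nv).
rewrite big_split /= !prod_if_const -/(n_alpha V' F) -/(n_beta V' F).
rewrite expfzDr // -exprnN -exprnP exprD; move: (phi_gold R) (sqrt5 R) => p s.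
by rewrite !exprMn exprVn mulrACA.
Qed.
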